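(* Let $(b_n)_{n\ge 1}$ be a sequence of positive integers and consider the $(\{b_n\},\{0,1\},0)$-Sequence (that is, $A_n=\{0,1\}$ for all $n$). For a positive integer $x$, let $Y_n(x)=1$ if an element of the $n$-th bin appears in the legal decomposition of $x$, and $Y_n(x)=0$ otherwise; thus, if the largest summand in the decomposition of $x$ is from bin $N$, then the total number of summands in this decomposition is $Y_1(x)+\cdots+Y_N(x)$. If $\sum_{n=1}^\infty 1/b_n$ diverges, then the distribution of the number of summands of integers whose largest summand is in bin $N$ (with $x$ chosen uniformly at random among all such integers) converges to a Gaussian in the sense of Lyapunov as $N\to\infty$.
   Context: The $(\{b_n\},\{0,1\},0)$-Sequence is a sequence of positive integers arranged consecutively in bins: the first $b_1$ terms form bin 1, the next $b_2$ terms form bin 2, and so on. A legal decomposition is a choice of finitely many terms with at most one term from each bin (no other restriction); it is a decomposition of the sum of the chosen terms. The sequence is constructed recursively: the first term is $1$; once the first $k$ terms have been constructed, the next term (placed in the next available position, filling the bins in order) is the least positive integer having no legal decomposition using only the first $k$ terms. For this sequence every positive integer has exactly one legal decomposition. For each $N$, choose $x$ uniformly at random from the finite set of positive integers whose decomposition has its largest summand in bin $N$. Then $Y_1,\dots,Y_N$ are independent random variables; put $\mu_n=\mathbb{E}[Y_n]$ and $s_N^2=\sum_{n=1}^N\mathrm{Var}(Y_n)$ under this choice. ''Converges to a Gaussian in the sense of Lyapunov as $N\to\infty$'' means that the Lyapunov condition holds, i.e. there is $\delta>0$ with $$\lim_{N\to\infty}\frac{1}{s_N^{2+\delta}}\sum_{n=1}^N\mathbb{E}\bigl[|Y_n-\mu_n|^{2+\delta}\bigr]=0,$$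 and hence $\frac1{s_N}\sum_{n=1}^N(Y_n-\mu_n)$ converges in distribution to the standard normal distribution as $N\to\infty$. *)

(* Defs.v *)
From HB Require Import structures.
From mathcomp Require Export all_boot all_order all_algebra finmap.
From mathcomp Require Export all_classical all_reals all_analysis.

Set Implicit Arguments.
Unset Strict Implicit.
Unset Printing Implicit Defensive.

Import Order.TTheory GRing.Theory Num.Theory.
Import numFieldNormedType.Exports.

Local Open Scope fset_scope.
Local Open Scope classical_set_scope.
Local Open Scope ring_scope.

(* Bins are numbered from 1 (the value [b 0] is never used), whereas the
   positions of the terms of the sequence are numbered from 0.  A choice of
   finitely many terms is given by the finite set of their positions. *)
Definition in_bin (b : nat -> nat) (n i : nat) : bool :=
  (\sum_(1 <= m < n) b m <= i < \sum_(1 <= m < n.+1) b m)%N.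

Definition legal (b : nat -> nat) (S : {fset nat}) : Prop :=
  forall n i j : nat,
    i \in S -> j \in S -> in_bin b n i -> in_bin b n j -> i = j.

(* [s] lists the terms constructed so far. *)
Definition decomposable (b : nat -> nat) (s : seq nat) (x : nat) : Prop :=
  exists S : {fset nat},
    [/\ legal b S,
        forall i : nat, i \in S -> (i < size s)%N &
        x = (\sum_(i <- S) nth 0 s i)%N].

Definition new_term (b : nat -> nat) (s : seq nat) (x : nat) : bool :=
  (0 < x)%N && ~~ `[< decomposable b s x >].

Lemma new_term_exists (b : nat -> nat) (s : seq nat) : exists x, new_term b s x.
Proof.
exists (\sum_(i <- iota 0 (size s)) nth 0 s i).+1%N.
rewrite /new_term ltn0Sn /=; apply/asboolPn => -[S [_ Ss xE]].
suff : (\sum_(i <- S) nth 0 s i <= \sum_(i <- iota 0 (size s)) nth 0 s i)%N.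
  by rewrite -xE ltnn.
rewrite [leqRHS](bigID (fun i => i \in S)) /= -[X in (_ <= X + _)%N]big_filter.
have SE : perm_eq [seq i <- iota 0 (size s) | i \in S] S.
  apply: uniq_perm; rewrite ?filter_uniq ?iota_uniq ?fset_uniq// => i.
  rewrite mem_filter mem_iota add0n /=.
  by apply/andP/idP => [[]//|iS]; split => //; exact: Ss.
by rewrite (perm_big _ SE) leq_addr.
Qed.

Definition next_term (b : nat -> nat) (s : seq nat) : nat :=
  ex_minn (new_term_exists b s).

Fixpoint first_terms (b : nat -> nat) (k : nat) : seq nat :=
  if k is k'.+1 then
    rcons (first_terms b k') (next_term b (first_terms b k'))
  else [::].

Definition bin_term (b : nat -> nat) (k : nat) : nat :=
  next_term b (first_terms b k).

Lemma bin_term0 (b : nat -> nat) : bin_term b 0 = 1%N.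
Proof.
rewrite /bin_term /next_term /=; case: ex_minnP => m /andP[m0 _] mmin.
apply/eqP; rewrite eqn_leq m0 andbT; apply: mmin.
rewrite /new_term /=; apply/asboolPn => -[S [_ S0 /esym]].
by rewrite big_seq big1 // => i /S0; rewrite ltn0.
Qed.

Definition legal_decomposition (b : nat -> nat) (x : nat) (S : {fset nat}) :
    Prop :=
  legal b S /\ x = (\sum_(i <- S) bin_term b i)%N.

(* The legal decomposition of [x]: it exists and is unique when all the [b n],
   n >= 1, are positive; [fset0] is a dummy default. *)
Definition decomposition (b : nat -> nat) (x : nat) : {fset nat} :=
  xget fset0 [set S | legal_decomposition b x S].

Definition largest_in_bin (b : nat -> nat) (N x : nat) : Prop :=
  exists i : nat,
    [/\ i \in decomposition b x,
        forall j : nat, j \in decomposition b x ->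
          (bin_term b j <= bin_term b i)%N &
        in_bin b N i].

Definition level (b : nat -> nat) (N : nat) : set nat :=
  [set x | (0 < x)%N /\ largest_in_bin b N x].

Section uniform_choice.
Variables (R : realType) (b : nat -> nat).

Definition Y (n x : nat) : R :=
  if `[< exists i : nat, i \in decomposition b x /\ in_bin b n i >] then 1
  else 0.

(* Expectation and probability for x uniform in the finite set [level b N]. *)
Definition expect (N : nat) (f : nat -> R) : R :=
  (\sum_(x <- fset_set (level b N)) f x) / #|` fset_set (level b N)|%:R.

Definition prob (N : nat) (A : set nat) : R :=
  #|` fset_set (level b N `&` A)|%:R / #|` fset_set (level b N)|%:R.

Definition Ymean (N n : nat) : R := expect N (Y n).

Definition Yvar (N n : nat) : R :=
  expect N (fun x => (Y n x - Ymean N n) ^+ 2).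

Definition stddev (N : nat) : R :=
  Num.sqrt (\sum_(1 <= n < N.+1) Yvar N n).

Definition lyapunov_condition : Prop :=
  exists2 delta : R, 0 < delta &
    ((stddev N `^ (2 + delta))^-1 *
       \sum_(1 <= n < N.+1)
          expect N (fun x => `|Y n x - Ymean N n| `^ (2 + delta)))
      @[N --> \oo] --> (0 : R).

(* Convergence in distribution to N(0,1): pointwise convergence of the
   cumulative distribution functions (that of N(0,1) is continuous). *)
Definition standardized_sum_cvg_normal : Prop :=
  forall t : R,
    (prob N [set x |
       (stddev N)^-1 * \sum_(1 <= n < N.+1) (Y n x - Ymean N n) <= t])%:E
      @[N --> \oo] --> normal_prob (0 : R) 1 `]-oo, t].

End uniform_choice.

(* Main.v *)
Require Import Defs.
From mathcomp Require Import measurable_realfun zify lra ring.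

Set Implicit Arguments.
Unset Strict Implicit.
Unset Printing Implicit Defensive.

Import Order.TTheory GRing.Theory Num.Theory.
Import numFieldNormedType.Exports.

Local Open Scope classical_set_scope.
Local Open Scope ring_scope.

(** With [P n] the product of the [b m + 1], [m <= n], the terms of bin [n + 1]
    are the multiples [k P n], [1 <= k <= b (n + 1)]: legal decompositions are
    the expansions in the mixed radix [b m + 1], and the integers whose largest
    summand is in bin [N + 1] are those of [P N, P (N + 1)[.  Hence [Y_1 .. Y_N]
    are independent, bounded by 1, and [Y_n] has variance
    [b n / (b n + 1)^2 >= 1 / (4 b n)] for [n < N], so that [s_N] tends to
    infinity.  As [|Y_n - mu_n| <= 1], the Lyapunov ratio with [delta = 1] is at
    most [1 / s_N].

    The central limit theorem is proved by Stein's method: if [f'] is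
    [K]-Lipschitz then [|E (f' W - W f W)| <= 2 K / s_N] for the standardized
    sum [W].  For a Lipschitz [h] with compact support and Gaussian mean zero,
    the equation [f' - x f = h] has a solution with compact support, which
    avoids tail estimates.  Applied to [h = I2 h1 - I1 h2], where [h1] is a
    trapezoid close to the indicator of ]-oo, t], [h2] a wide trapezoid and
    [I1], [I2] their Gaussian means, this gives the limit of the distribution
    functions, the mass far from 0 being controlled by Chebyshev's inequality. *)

(** Indices are shifted by one: [bin_start b n], [place b n] and [digit b n] all concern bin
    [n + 1]. They are the position of its first term, the unit of which its terms are multiples, and
    the rank of the term chosen in it, counted from 1, with 0 for none. *)
Definition bin_start (b : nat -> nat) (n : nat) : nat :=
  (\sum_(1 <= m < n.+1) b m)%N.

Definition place (b : nat -> nat) (n : nat) : nat :=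
  (\prod_(1 <= m < n.+1) (b m).+1)%N.

Definition digit (b : nat -> nat) (n x : nat) : nat :=
  (x %/ place b n %% (b n.+1).+1)%N.

(** * The mixed radix system *)

Section mixed_radix.
Variable b : nat -> nat.
Hypothesis b_gt0 : forall n, (1 <= n)%N -> (0 < b n)%N.
Local Open Scope nat_scope.

Lemma bin_start0 : bin_start b 0 = 0.
Proof. by rewrite /bin_start big_geq. Qed.

Lemma bin_startS n : bin_start b n.+1 = bin_start b n + b n.+1.
Proof. by rewrite /bin_start big_nat_recr. Qed.

Lemma leq_bin_start m n : m <= n -> bin_start b m <= bin_start b n.
Proof.
elim: n => [|n IHn]; first by rewrite leqn0 => /eqP->.
by rewrite leq_eqVlt => /predU1P[->//|/IHn]; rewrite bin_startS; lia.
Qed.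

Lemma place0 : place b 0 = 1.
Proof. by rewrite /place big_geq. Qed.

Lemma placeS n : place b n.+1 = place b n * (b n.+1).+1.
Proof. by rewrite /place big_nat_recr. Qed.

Lemma place_gt0 n : 0 < place b n.
Proof. by elim: n => [|n IHn]; rewrite ?place0 ?placeS ?muln_gt0 ?IHn. Qed.

Lemma dvdn_place m n : m <= n -> place b m %| place b n.
Proof.
elim: n => [|n IHn]; first by rewrite leqn0 => /eqP->.
rewrite leq_eqVlt => /predU1P[->//|/IHn mn].
by rewrite placeS dvdn_mulr.
Qed.

Lemma leq_place m n : m <= n -> place b m <= place b n.
Proof. by move=> mn; rewrite dvdn_leq ?place_gt0 ?dvdn_place. Qed.

Lemma digit_small m x : x < place b m -> digit b m x = 0.
Proof. by move=> xm; rewrite /digit divn_small ?mod0n. Qed.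

(** For [m < n], [place b n] is a multiple of [place b m.+1], so after division by [place b m] the
    added part vanishes modulo the radix. *)
Lemma digit_lt m n a r : m < n -> digit b m (a * place b n + r) = digit b m r.
Proof.
move=> /dvdn_place/dvdnP[q ->].
rewrite /digit placeS.
have -> : a * (q * (place b m * (b m.+1).+1)) =
    a * q * (b m.+1).+1 * place b m by lia.
by rewrite divnMDl ?place_gt0// modnMDl.
Qed.

Lemma digit_eq n a r : a <= b n.+1 -> r < place b n ->
  digit b n (a * place b n + r) = a.
Proof.
move=> an rn; rewrite /digit divnMDl ?place_gt0// divn_small// addn0.
by rewrite modn_small.
Qed.

Lemma digit_gt m n a r : n < m -> a <= b n.+1 -> r < place b n ->
  digit b m (a * place b n + r) = 0.
Proof.
move=> nm an rn; apply: digit_small.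
apply: leq_trans (leq_place nm); rewrite placeS.
by rewrite [place b n * _]mulnC mulSn addnC -addSn leq_add// leq_mul2r an orbT.
Qed.

Lemma in_binS n i :
  in_bin b n.+1 i = (bin_start b n <= i < bin_start b n.+1).
Proof. by []. Qed.

Lemma in_binP n i : reflect
  (exists m k, [/\ n = m.+1, k < b m.+1 & i = bin_start b m + k])
  (in_bin b n i).
Proof.
apply: (iffP idP) => [|[m [k [-> km ->]]]].
  case: n => [|n]; first by rewrite /in_bin !big_geq//= ltn0 andbF.
  rewrite in_binS bin_startS => /andP[ni im].
  by exists n, (i - bin_start b n); split => //; lia.
by rewrite in_binS bin_startS; lia.
Qed.

Lemma bin_start_inj m k n j : k < b m.+1 -> j < b n.+1 ->
  bin_start b m + k = bin_start b n + j -> m = n /\ k = j.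
Proof.
move=> km jn e; case: (ltngtP m n) => [mn|nm|mn].
- by have := leq_bin_start mn; rewrite bin_startS; lia.
- by have := leq_bin_start nm; rewrite bin_startS; lia.
- by subst m; split => //; lia.
Qed.

Lemma bin_exists i : exists n k, k < b n.+1 /\ i = bin_start b n + k.
Proof.
elim: i => [|i [n [k [kn ->]]]].
  by exists 0, 0; rewrite bin_start0; split => //; exact: b_gt0.
case: (ltnP k.+1 (b n.+1)) => [kn'|nk]; first by exists n, k.+1; rewrite addnS.
exists n.+1, 0; rewrite bin_startS; split; [exact: b_gt0|lia].
Qed.

Lemma leq_bin_start_index n : n <= bin_start b n.
Proof.
by elim: n => // n IHn; rewrite bin_startS; have := @b_gt0 n.+1; lia.
Qed.

(** * Legal choices as mixed radix expansions *)

Lemma legalS (S S' : {fset nat}) : (S' `<=` S)%fset -> legal b S -> legal b S'.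
Proof.
by move=> /fsubsetP SS' lS n i j /SS' iS /SS' jS; exact: lS iS jS.
Qed.

(* [t] need only have the right values below [k], so that the lemmas apply
   while the sequence is being constructed. *)
Definition place_values (t : nat -> nat) (k : nat) :=
  forall n j, j < b n.+1 -> bin_start b n + j < k ->
    t (bin_start b n + j) = j.+1 * place b n.

Definition below (S : {fset nat}) (k : nat) := forall i, i \in S -> i < k.

Definition digits_of (S : {fset nat}) (x : nat) := forall m k, k < b m.+1 ->
  (bin_start b m + k \in S) = (digit b m x == k.+1).

(** Only the first [j] terms of bin [n + 1] are available. A legal [S] contains at most one of them;
    removing it leaves a choice from the earlier bins, whose sum [r] is below [place b n], and
    putting it back adds a multiple of [place b n] that sets digit [n] alone. The earlier bins enter
    as a premise, so that the step serves both full bins and a bin under construction. *)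
Lemma legal_digits_step (t : nat -> nat) n j (S : {fset nat}) :
  (forall S' : {fset nat}, legal b S' -> below S' (bin_start b n) ->
    \sum_(i <- S') t i < place b n /\ digits_of S' (\sum_(i <- S') t i)) ->
  place_values t (bin_start b n + j) -> j <= b n.+1 ->
  legal b S -> below S (bin_start b n + j) ->
  \sum_(i <- S) t i < j.+1 * place b n /\ digits_of S (\sum_(i <- S) t i).
Proof.
move=> IH tP jn lS Sj.
have [[k [kj kS]]|nS] := pselect (exists k, k < j /\ bin_start b n + k \in S);
    last first.
  have Sn : below S (bin_start b n).
    move=> i iS; rewrite ltnNge; apply/negP => ni; apply: nS.
    exists (i - bin_start b n); rewrite subnKC//; have := Sj _ iS.
    by split => //; lia.
  have [x1 x2] := IH _ lS Sn; split => //.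
  by rewrite (leq_trans x1)// leq_pmull.
have kn : k < b n.+1 by lia.
set i0 := bin_start b n + k in kS *; set S' := (S `\ i0)%fset.
have i0b : in_bin b n.+1 i0 by apply/in_binP; exists n, k.
have S'n : below S' (bin_start b n).
  move=> i; rewrite !inE => /andP[ii0 iS]; rewrite ltnNge; apply/negP => ni.
  move/eqP: ii0; apply; apply: (lS n.+1) => //.
  by rewrite in_binS bin_startS; have := Sj _ iS; lia.
have lS' : legal b S' by apply: legalS lS; exact: fsubD1set.
have [r1 r2] := IH _ lS' S'n; set r := \sum_(i <- S') t i in r1 r2.
have -> : \sum_(i <- S) t i = k.+1 * place b n + r.
  rewrite (big_fsetD1 i0) //= -/S' -/r tP//; lia.
split.
  have : k.+2 * place b n <= j.+1 * place b n by rewrite leq_mul2r ltnS kj orbT.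
  by rewrite mulSn; lia.
move=> m k' k'm.
have -> : (bin_start b m + k' \in S) =
    (bin_start b m + k' == i0) || (bin_start b m + k' \in S').
  by rewrite !inE; case: eqP => [->|//].
rewrite r2//; case: (ltngtP m n) => [mn|nm|mn].
- rewrite digit_lt//; case: eqP => //= /bin_start_inj[]//; lia.
- rewrite digit_gt//.
  rewrite ?(digit_small (leq_trans r1 (leq_place (ltnW nm)))) ?orbF//.
  by apply/eqP => /bin_start_inj[]//; lia.
- subst m; rewrite digit_eq// digit_small//= orbF eqn_add2l eqSS; exact: eq_sym.
Qed.

Lemma legal_digits t n (S : {fset nat}) :
  place_values t (bin_start b n) -> legal b S -> below S (bin_start b n) ->
  \sum_(i <- S) t i < place b n /\ digits_of S (\sum_(i <- S) t i).
Proof.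
elim: n S => [|n IHn] S.
  rewrite bin_start0 => _ _ S0.
  have -> : S = fset0 by apply/fsetP => i; rewrite inE; apply/negP => /S0.
  rewrite big_seq_fset0 place0; split => // m k km.
  by rewrite inE digit_small ?place_gt0.
rewrite bin_startS placeS mulnC => tP lS Sn.
apply: legal_digits_step => // S' lS' S'n; apply: IHn => // m j jm jn.
by apply: tP => //; lia.
Qed.

Lemma legal_lt t n j (S : {fset nat}) :
  place_values t (bin_start b n + j) -> j <= b n.+1 ->
  legal b S -> below S (bin_start b n + j) ->
  \sum_(i <- S) t i < j.+1 * place b n.
Proof.
move=> tP jn lS Sj; apply: (proj1 (legal_digits_step _ tP jn lS Sj)).
move=> S' lS' S'n; apply: legal_digits => // m k km kn; apply: tP => //; lia.
Qed.

(** Euclidean division by [place b n]: the remainder is decomposed in the earlier bins, and a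
    nonzero quotient [a.+1] selects the term at position [bin_start b n + a]. *)
Lemma legal_exists_step t n j x :
  (forall y, y < place b n -> exists S : {fset nat},
    [/\ legal b S, below S (bin_start b n) & y = \sum_(i <- S) t i]) ->
  place_values t (bin_start b n + j) -> j <= b n.+1 ->
  x < j.+1 * place b n -> exists S : {fset nat},
    [/\ legal b S, below S (bin_start b n + j) & x = \sum_(i <- S) t i].
Proof.
move=> IH tP jn xj.
have [S [lS Sn rE]] := IH _ (ltn_pmod x (place_gt0 n)).
have : x %/ place b n <= j by rewrite -ltnS ltn_divLR ?place_gt0.
have := divn_eq x (place b n); case: (x %/ place b n) => [|a] xE aj.
  exists S; split => // [i /Sn|]; first by lia.
  by rewrite -rE.
set i0 := bin_start b n + a.
have i0S : i0 \notin S by apply/negP => /Sn; rewrite /i0; lia.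
have i0bin m : in_bin b m i0 -> m = n.+1.
  by move=> /in_binP[m' [k [-> km /bin_start_inj[]//]]]; lia.
have nbin i m : i \in S -> in_bin b m i -> m <> n.+1.
  by move=> /Sn + + mn; rewrite mn in_binS; lia.
exists (i0 |` S)%fset; split.
- move=> m i i'; rewrite !inE => /predU1P[->|iS] /predU1P[->|i'S] //.
  + by move=> /i0bin mn /(nbin _ _ i'S).
  + by move=> /(nbin _ _ iS) mn /i0bin.
  + exact: lS iS i'S.
- by move=> i; rewrite !inE => /predU1P[->|/Sn]; rewrite /i0; lia.
- rewrite big_fsetU1//= -rE tP//; [lia|rewrite /i0; lia].
Qed.

Lemma legal_exists t n x : place_values t (bin_start b n) -> x < place b n ->
  exists S : {fset nat},
    [/\ legal b S, below S (bin_start b n) & x = \sum_(i <- S) t i].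
Proof.
elim: n x => [|n IHn] x.
  rewrite place0 => _; rewrite ltnS leqn0 => /eqP->.
  exists fset0; split => [m i j|i|]; rewrite ?inE// big_seq_fset0//.
rewrite bin_startS placeS mulnC => tP xn.
apply: legal_exists_step xn => // y yn; apply: IHn => // m k km kn.
by apply: tP => //; lia.
Qed.

(** * The terms of the sequence and the decompositions *)

Lemma size_first_terms k : size (first_terms b k) = k.
Proof. by elim: k => //= k IHk; rewrite size_rcons IHk. Qed.

Lemma nth_first_terms k i : i < k -> nth 0 (first_terms b k) i = bin_term b i.
Proof.
elim: k => // k IHk; rewrite /= nth_rcons size_first_terms ltnS leq_eqVlt.
by move=> /predU1P[->|ik]; rewrite ?ltnn ?eqxx// ik IHk.
Qed.

(** Strong induction on the number of terms constructed. When the earlier terms have the expected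
    values, the decomposable integers are exactly those below [j.+1 * place b n], so this bound is
    the least integer missed. *)
Lemma bin_term_values k : place_values (bin_term b) k.
Proof.
elim/ltn_ind: k => k IH n j jn jk.
set i := bin_start b n + j in jk *.
have tP : place_values (nth 0 (first_terms b i)) i.
  by move=> n' j' jn' ji'; rewrite nth_first_terms//; exact: IH jk _ _ jn' ji'.
have decE x : decomposable b (first_terms b i) x <-> x < j.+1 * place b n.
  split => [[S [lS]]|xj]; rewrite ?size_first_terms.
    by move=> Si ->; apply: legal_lt => //; exact: ltnW.
  have [|||S [lS Si xE]] := @legal_exists_step _ _ _ x _ tP => //.
  - move=> y; apply: legal_exists => m k' km kn; apply: tP => //; lia.
  - exact: ltnW.
  - by exists S; split; rewrite ?size_first_terms.
rewrite /bin_term /next_term; case: ex_minnP => m /andP[m0 /asboolPn mN] mmin.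
apply/eqP; rewrite eqn_leq; apply/andP; split; last first.
  by rewrite leqNgt; apply/negP => /decE.
apply: mmin.
rewrite /new_term muln_gt0 place_gt0/=.
by apply/asboolPn => /decE; rewrite ltnn.
Qed.

Lemma bin_termE n j : j < b n.+1 ->
  bin_term b (bin_start b n + j) = j.+1 * place b n.
Proof. by move=> jn; apply: (@bin_term_values (bin_start b n + j).+1). Qed.

Lemma fset_below (S : {fset nat}) : exists n, below S (bin_start b n).
Proof.
exists (\max_(i <- S) i).+1 => i iS.
by apply: leq_trans (leq_bin_start_index _); rewrite ltnS leq_bigmax_seq.
Qed.

Lemma legal_decomposition_digits x S :
  legal_decomposition b x S -> digits_of S x.
Proof.
move=> [lS ->]; have [n Sn] := fset_below S.
by have [] := legal_digits (@bin_term_values _) lS Sn.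
Qed.

Lemma legal_decomposition_unique x S S' :
  legal_decomposition b x S -> legal_decomposition b x S' -> S = S'.
Proof.
move=> /legal_decomposition_digits dS /legal_decomposition_digits dS'.
apply/fsetP => i; have [n [k [kn ->]]] := bin_exists i.
by rewrite dS// dS'.
Qed.

(** Guarantees that the first [x] bins suffice to decompose [x]. *)
Lemma ltn_place n : n < place b n.
Proof.
elim: n => [|n IHn]; first by rewrite place0.
by rewrite placeS mulnS; have := @b_gt0 n.+1; have := place_gt0 n; nia.
Qed.

Lemma decompositionP x : legal_decomposition b x (decomposition b x).
Proof.
have [S [lS _ xE]] := legal_exists (@bin_term_values _) (ltn_place x).
exact: (@xgetPex _ fset0 [set S | legal_decomposition b x S])
  (ex_intro _ S (conj lS xE)).
Qed.

Lemma decomposition_below n x : x < place b n ->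
  below (decomposition b x) (bin_start b n).
Proof.
move=> /(legal_exists (@bin_term_values _))[S [lS Sn xE]].
by rewrite (legal_decomposition_unique (decompositionP x) (conj lS xE)).
Qed.

Lemma in_decomposition x m k : k < b m.+1 ->
  (bin_start b m + k \in decomposition b x) = (digit b m x == k.+1).
Proof. exact/legal_decomposition_digits/decompositionP. Qed.

Lemma has_bin_digit n x :
  (exists i, i \in decomposition b x /\ in_bin b n.+1 i) <-> digit b n x != 0.
Proof.
split => [[i [iS /in_binP[m [k [[<-] km iE]]]]]|].
  by move: iS; rewrite iE in_decomposition// => /eqP->.
case E : (digit b n x) => [|k] // _.
have kn : k < b n.+1 by rewrite -ltnS -E ltn_mod.
exists (bin_start b n + k); rewrite in_decomposition// E; split => //.
by apply/in_binP; exists n, k.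
Qed.

Lemma levelE N : level b N.+1 = [set x | place b N <= x < place b N.+1].
Proof.
apply/seteqP; split => x /=.
  move=> [x0 [i [iS imax /in_binP[m [k [[<-] km iE]]]]]].
  have [lS xE] := decompositionP x.
  have tiE : bin_term b i = k.+1 * place b N by rewrite iE bin_termE.
  apply/andP; split.
    rewrite xE (big_fsetD1 i)//= tiE; have := place_gt0 N; nia.
  rewrite xE; apply: (proj1 (legal_digits (@bin_term_values _) lS _)) => j jS.
  rewrite ltnNge; apply/negP => Nj; have := imax _ jS.
  (* A term of a bin after [N + 1] is at least [place b N.+1], which exceeds every term of bin
     [N + 1], against the maximality of [i]. *)
  have [n [l [ln jE]]] := bin_exists j.
  have Nn : N < n.
    rewrite ltnNge; apply/negP => nN; move: Nj.
    by have := @leq_bin_start n.+1 N.+1 nN; rewrite jE (bin_startS n); lia.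
  rewrite tiE jE bin_termE// leqNgt => /negP; apply.
  have := leq_place Nn; rewrite placeS; have := place_gt0 N; nia.
move=> /andP[Nx xN]; split; first exact: leq_trans (place_gt0 N) Nx.
have := divn_eq x (place b N).
have : x %/ place b N < (b N.+1).+1.
  by rewrite ltn_divLR ?place_gt0// mulnC -placeS.
have rN := ltn_pmod x (place_gt0 N).
case: (x %/ place b N) => [|k] kN xE; first by lia.
have dN : digit b N x = k.+1 by rewrite xE digit_eq.
exists (bin_start b N + k).
rewrite in_decomposition ?dN//; split => //; last first.
  by apply/in_binP; exists N, k.
move=> j; have [n [l [ln ->]]] := bin_exists j => jS.
have := decomposition_below xN jS; rewrite bin_startS => jN.
move: jS; rewrite in_decomposition// => /eqP djE; rewrite !bin_termE//.
have nN : n <= N.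
  rewrite leqNgt; apply/negP => /leq_bin_start; rewrite bin_startS; lia.
move: nN; rewrite leq_eqVlt => /predU1P[nN|nN].
  by move: djE; rewrite nN dN => -[->].
have := leq_place nN; rewrite placeS; have := place_gt0 N; nia.
Qed.

End mixed_radix.

(** * Stein's method for finite sums *)

(** A normalized monotone linear functional on all functions. This form covers both the uniform mean
    over a level and the law of the standardized sum, without building a probability space. *)
Definition expectation (R : realType) (T : Type) (E : (T -> R) -> R) : Prop :=
  [/\ forall f g, E (fun x => f x + g x) = E f + E g,
      forall a f, E (fun x => a * f x) = a * E f,
      forall f g, (forall x, f x <= g x) -> E f <= E g &
      E (fun=> 1) = 1].

Section expectation_theory.
Context {R : realType} {T : Type} {E : (T -> R) -> R}.
Hypothesis HE : expectation E.

Lemma expectD f g : E (fun x => f x + g x) = E f + E g.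
Proof. by have [-> _ _ _] := HE. Qed.

Lemma expectZ a f : E (fun x => a * f x) = a * E f.
Proof. by have [_ -> _ _] := HE. Qed.

Lemma expect_le f g : (forall x, f x <= g x) -> E f <= E g.
Proof. by have [_ _ h _] := HE; exact: h. Qed.

Lemma expect_cst a : E (fun=> a) = a.
Proof.
have [_ _ _ E1] := HE; rewrite -[RHS]mulr1 -E1 -expectZ.
by congr E; apply/funext => x; rewrite mulr1.
Qed.

Lemma expectB f g : E (fun x => f x - g x) = E f - E g.
Proof.
rewrite expectD; congr +%R; rewrite -mulN1r -expectZ.
by congr E; apply/funext => x; rewrite mulN1r.
Qed.

Lemma expect_sum N (f : nat -> T -> R) :
  E (fun x => \sum_(n < N) f n x) = \sum_(n < N) E (f n).
Proof.
elim: N => [|N IHN].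
  rewrite big_ord0 -[RHS]expect_cst; congr E.
  by apply/funext => x; rewrite big_ord0.
rewrite big_ord_recr/= -IHN -expectD.
by congr E; apply/funext => x; rewrite big_ord_recr.
Qed.

Lemma expect_norm_le f g : (forall x, `|f x| <= g x) -> `|E f| <= E g.
Proof.
move=> fg; rewrite ler_norml -mulN1r -expectZ.
by apply/andP; split; apply: expect_le => x; have := fg x;
  rewrite ler_norml ?mulN1r => /andP[].
Qed.

End expectation_theory.

Section stein_bound.
Context {R : realType} {T : Type}.
Variables (E : (T -> R) -> R) (N : nat) (xi : nat -> T -> R) (delta : R).
Hypothesis HE : expectation E.
Let W x := \sum_(n < N) xi n x.
Let var n := E (fun x => xi n x ^+ 2).
(** Independence enters through this hypothesis and the next one: [xi n] and its square are
    uncorrelated with every function of the sum of the other variables, [W x - xi n x]. *)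
Hypothesis xi_centered : forall n (v : R -> R), (n < N)%N ->
  E (fun x => xi n x * v (W x - xi n x)) = 0.
Hypothesis xi_var : forall n (v : R -> R), (n < N)%N ->
  E (fun x => xi n x ^+ 2 * v (W x - xi n x)) =
  var n * E (fun x => v (W x - xi n x)).
Hypothesis xi_le : forall n x, `|xi n x| <= delta.
Hypothesis var_sum : \sum_(n < N) var n = 1.

(** Each cross term [xi n x * (W x - xi n x)] has mean zero, by [xi_centered] with the identity for
    [v]. *)
Lemma expect_sum_sqr : E (fun x => W x ^+ 2) = 1.
Proof.
rewrite -var_sum.
transitivity
  (E (fun x => \sum_(n < N) (xi n x * (W x - xi n x) + xi n x ^+ 2))).
  congr E; apply/funext => x; rewrite expr2 {1}/W mulr_suml.
  by apply: eq_bigr => n _; ring.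
rewrite (expect_sum HE N (fun n x => xi n x * (W x - xi n x) + xi n x ^+ 2)).
by apply: eq_bigr => n _; rewrite (expectD HE) (@xi_centered n id)// add0r.
Qed.

(** Expand [f (W x)] around the leave-one-out sum [Wn x]. After multiplication by [xi n x], the
    constant term has mean zero, the linear term gives [var n] times the mean of [g (Wn x)], and the
    remainder is at most [L * delta * xi n x ^+ 2]. Returning from [Wn] to [W] inside [g] costs
    [L * delta] once more, whence the factor 2 after summing the variances. *)
Lemma stein_bound (f g : R -> R) (L : R) :
  (forall x u, `|f (x + u) - f x - u * g x| <= L * u ^+ 2) ->
  (forall x y, `|g x - g y| <= L * `|x - y|) ->
  `|E (fun x => g (W x) - W x * f (W x))| <= 2 * L * delta.
Proof.
move=> fg gL.
have L0 : 0 <= L.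
  by have := fg 0 1; rewrite expr1n mulr1; exact: le_trans.
have var0 n : 0 <= var n.
  by rewrite -(expect_cst HE 0); apply: (expect_le HE) => x; exact: sqr_ge0.
have step n : (n < N)%N ->
    `|E (fun x => xi n x * f (W x)) - var n * E (fun x => g (W x))| <=
    2 * L * delta * var n.
  move=> nN; set Wn := fun x => W x - xi n x.
  have WE x : W x = Wn x + xi n x by rewrite subrK.
  set r := fun x => xi n x * (f (W x) - f (Wn x) - xi n x * g (Wn x)).
  have -> : E (fun x => xi n x * f (W x)) = E r + var n * E (fun x => g (Wn x)).
    rewrite -[LHS]subr0 -(@xi_centered n f nN) -(@xi_var n g nN).
    rewrite -(expectB HE) -(expectD HE).
    by congr E; apply/funext => x; rewrite /r /Wn; ring.
  have rle : `|E r| <= L * delta * var n.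
    rewrite -(expectZ HE); apply: (expect_norm_le HE) => x.
    rewrite normrM; have := fg (Wn x) (xi n x); rewrite -WE => fgx.
    by rewrite -mulrA mulrCA ler_pM.
  have gle : `|E (fun x => g (Wn x)) - E (fun x => g (W x))| <= L * delta.
    rewrite -(expectB HE) -(expect_cst HE (L * delta)).
    apply: (expect_norm_le HE) => x; apply: le_trans (gL _ _) _.
    by rewrite ler_wpM2l// WE opprD addNKr normrN.
  rewrite -addrA -mulrBr; apply: le_trans (ler_normD _ _) _.
  rewrite normrM (ger0_norm (var0 n)).
  have := ler_wpM2l (var0 n) gle; lra.
have -> : E (fun x => g (W x) - W x * f (W x)) =
    - \sum_(n < N)
        (E (fun x => xi n x * f (W x)) - var n * E (fun x => g (W x))).
  rewrite sumrB -mulr_suml var_sum mul1r opprB (expectB HE); congr (_ - _).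
  rewrite -(expect_sum HE N (fun n x => xi n x * f (W x))).
  by congr E; apply/funext => x; rewrite {1}/W mulr_suml.
rewrite normrN; apply: le_trans (ler_norm_sum _ _ _) _.
have -> : 2 * L * delta = \sum_(n < N) 2 * L * delta * var n.
  by rewrite -mulr_sumr var_sum mulr1.
by apply: ler_sum => n _; exact: step.
Qed.

End stein_bound.

(** * Independence of the digits *)

Section digit_independence.
Variables (R : realType) (b : nat -> nat).

Lemma big_nat_divmod (p q : nat) (F : nat -> R) :
  \sum_(0 <= x < q * p) F x =
  \sum_(0 <= d < q) \sum_(0 <= x < p) F (d * p + x)%N.
Proof.
elim: q => [|q IHq]; first by rewrite mul0n !big_geq.
rewrite big_nat_recr//= -IHq (@big_cat_nat _ _ _ (q * p))//=; last first.
  by rewrite leq_mul2r leqnSn orbT.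
congr +%R; rewrite -{1}[(q * p)%N]add0n big_addn mulSn addnK.
by apply: eq_bigr => x _; rewrite addnC.
Qed.

(** Expresses that [v] is a function of the digits other than [n], by comparing integers below
    [place b N] instead of exhibiting a factorization. *)
Definition digit_invariant (N n : nat) (v : nat -> R) := forall x y,
  (x < place b N)%N -> (y < place b N)%N ->
  (forall m, m != n -> digit b m x = digit b m y) -> v x = v y.

(** Induction on [N], splitting off the top digit. If it is digit [n], then [v] is constant along it
    and the double sum factors; otherwise the induction hypothesis applies to each slice where the
    top digit is fixed. *)
Lemma sum_digit_indep N n (u v : nat -> R) :
  (n < N)%N -> digit_invariant N n v ->
  (\sum_(0 <= x < place b N) u (digit b n x) * v x) * (b n.+1).+1%:R =
  (\sum_(0 <= d < (b n.+1).+1) u d) * \sum_(0 <= x < place b N) v x.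
Proof.
elim: N v => // N IHN v; rewrite ltnS leq_eqVlt placeS mulnC !big_nat_divmod.
move=> /predU1P[-> vN|nN vn].
  have vE d x : (d <= b N.+1)%N -> (x < place b N)%N ->
      v (d * place b N + x)%N = v x.
    move=> dN xN.
    have dxN : (d * place b N + x < place b N.+1)%N.
      by rewrite placeS; nia.
    apply: vN => // [|m]; first exact: leq_trans xN (leq_place _ (leqnSn N)).
    rewrite neq_ltn => /orP[mN|Nm].
      by rewrite digit_lt.
    rewrite digit_gt// digit_small//.
    by apply: leq_trans xN (leq_place _ (ltnW Nm)).
  transitivity ((\sum_(0 <= d < (b N.+1).+1) u d) *
      (\sum_(0 <= x < place b N) v x) * (b N.+1).+1%:R).
    congr (_ * _); rewrite mulr_suml; apply: eq_big_nat => d /andP[_ dN].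
    rewrite mulr_sumr; apply: eq_big_nat => x /andP[_ xN].
    by rewrite digit_eq// vE.
  rewrite -mulrA; congr (_ * _).
  rewrite mulr_natr -[in LHS](subn0 (b N.+1).+1) -sumr_const_nat.
  apply: eq_big_nat => d /andP[_ dN]; apply: eq_big_nat => x /andP[_ xN].
  by rewrite vE.
rewrite mulr_suml mulr_sumr; apply: eq_big_nat => d /andP[_ dN].
rewrite -IHN//; last first.
  move=> x y xN yN xy; apply: vn => [||m mn];
    [by rewrite placeS; nia|by rewrite placeS; nia|].
  case: (ltngtP m N) => [mN|Nm|->]; last by rewrite !digit_eq.
  - by rewrite !digit_lt// xy.
  - by rewrite !digit_gt.
by congr (_ * _); apply: eq_bigr => x _; rewrite digit_lt.
Qed.

(** * The uniform law on a level *)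

Hypothesis b_gt0 : forall n, (1 <= n)%N -> (0 < b n)%N.

Lemma finite_level N : finite_set (level b N.+1).
Proof.
rewrite levelE//; apply: (@sub_finite_set _ _ `I_(place b N.+1)).
  by move=> x /= /andP[].
exact: finite_II.
Qed.

Lemma perm_level N :
  perm_eq (fset_set (level b N.+1)) (index_iota (place b N) (place b N.+1)).
Proof.
apply: uniq_perm; [exact: fset_uniq|exact: iota_uniq|move=> x].
rewrite in_fset_set; last exact: finite_level.
rewrite mem_index_iota levelE//.
by apply/idP/idP; rewrite inE.
Qed.

Lemma level_size_gt0 N : (0 < (place b N.+1 - place b N)%:R :> R).
Proof.
rewrite ltr0n subn_gt0 placeS; have := place_gt0 b N; have := @b_gt0 N.+1 isT.
nia.
Qed.

Lemma expectE N F : expect b N.+1 F =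
  (\sum_(place b N <= x < place b N.+1) F x)
  / (place b N.+1 - place b N)%:R :> R.
Proof.
rewrite /expect (perm_big _ (perm_level N)).
by rewrite (perm_size (perm_level N)) size_iota.
Qed.

Lemma expectation_expect N : expectation (expect (R := R) b N.+1).
Proof.
split => [f g|a f|f g fg|]; rewrite !expectE.
- by rewrite big_split mulrDl.
- by rewrite -mulr_sumr mulrA.
- by rewrite ler_pM2r ?invr_gt0 ?level_size_gt0// ler_sum.
- by rewrite sumr_const_nat divff// gt_eqF// level_size_gt0.
Qed.

Lemma eq_expect N (F G : nat -> R) :
  (forall x, (place b N <= x < place b N.+1)%N -> F x = G x) ->
  expect b N.+1 F = expect b N.+1 G.
Proof. by move=> FG; rewrite !expectE; congr (_ / _); exact: eq_big_nat. Qed.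

Lemma top_digit N x : (x < place b N.+1)%N ->
  (digit b N x != 0)%N = (place b N <= x)%N.
Proof.
move=> xN; case: leqP => [Nx|/digit_small->//].
rewrite /digit modn_small.
  by rewrite -lt0n divn_gt0 ?place_gt0.
by rewrite ltn_divLR ?place_gt0// mulnC -placeS.
Qed.

Lemma YE n x : Y R b n.+1 x = (digit b n x != 0%N)%:R.
Proof.
rewrite /Y; case: asboolP => [/(has_bin_digit b_gt0)->//|h].
by case: eqVneq => // d0; case: h; apply/(has_bin_digit b_gt0).
Qed.

Lemma Y_top N x : (place b N <= x < place b N.+1)%N -> Y R b N.+1 x = 1.
Proof. by move=> /andP[Nx xN]; rewrite YE top_digit// Nx. Qed.

(** Turns a sum over a level into one over all integers below [place b N.+1], the range in which the
    digits are independent, at the price of an indicator of the top digit. *)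
Lemma level_sumE N (F : nat -> R) :
  \sum_(place b N <= x < place b N.+1) F x =
  \sum_(0 <= x < place b N.+1) (digit b N x != 0%N)%:R * F x.
Proof.
rewrite [RHS](@big_cat_nat _ _ _ (place b N))//=; last exact: leq_place.
rewrite [X in _ = X + _]big_nat_cond [X in _ = X + _]big1 ?add0r.
  by apply: eq_big_nat => x /andP[Nx xN]; rewrite top_digit// Nx mul1r.
by move=> x /andP[/andP[_ xN] _]; rewrite digit_small// mul0r.
Qed.

(** The indicator of a nonzero top digit depends on digit [N], which differs from [n]; it can
    therefore be absorbed into [v]. *)
Lemma expect_digit_indep N n (u v : nat -> R) :
  (n < N)%N -> digit_invariant N.+1 n v ->
  expect b N.+1 (fun x => u (digit b n x) * v x) =
  (\sum_(0 <= d < (b n.+1).+1) u d) / (b n.+1).+1%:R * expect b N.+1 v.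
Proof.
move=> nN vn; rewrite !expectE !level_sumE mulrA; congr (_ / _).
rewrite mulrAC -sum_digit_indep; last 2 first.
- exact: ltnW.
- move=> x y xN yN xy; congr (_ * _); last exact: vn.
  by rewrite xy// gt_eqF.
by rewrite mulfK ?pnatr_eq0//; apply: eq_bigr => x _; rewrite mulrCA.
Qed.

(** For [n < N] this is independence of the digits. For [n = N] the variable is constantly 1 on the
    level, so it is independent of everything. *)
Lemma expect_Y_indep N n (u : R -> R) (v : nat -> R) :
  (n <= N)%N -> digit_invariant N.+1 n v ->
  expect b N.+1 (fun x => u (Y R b n.+1 x) * v x) =
  expect b N.+1 (fun x => u (Y R b n.+1 x)) * expect b N.+1 v.
Proof.
rewrite leq_eqVlt => /predU1P[-> _|nN vn].
  rewrite (@eq_expect N _ (fun x => u 1 * v x)); last by move=> x /Y_top->.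
  rewrite (@eq_expect N (fun x => u _) (fun=> u 1)); last by move=> x /Y_top->.
  have HE := expectation_expect N.
  by rewrite (expect_cst HE) (expectZ HE).
under eq_expect do rewrite YE.
under [X in _ = X * _]eq_expect do rewrite YE -[u _]mulr1.
rewrite (expect_digit_indep (fun d => u (d != 0%N)%:R) nN vn).
rewrite (expect_digit_indep (fun d => u (d != 0%N)%:R) (v := fun=> 1) nN)//.
by rewrite (expect_cst (expectation_expect N)) mulr1.
Qed.

Lemma YmeanE N n : (n < N)%N ->
  Ymean R b N.+1 n.+1 = (b n.+1)%:R / (b n.+1).+1%:R.
Proof.
move=> nN; rewrite /Ymean; under eq_expect do rewrite YE -[_%:R]mulr1.
rewrite (expect_digit_indep (fun d => (d != 0%N)%:R) (v := fun=> 1) nN)//.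
rewrite (expect_cst (expectation_expect N)) mulr1; congr (_ / _).
rewrite big_nat_recl//= add0r sumr_const_nat subn0//.
Qed.

Lemma Y_bounds n x : 0 <= Y R b n x <= 1.
Proof. by rewrite /Y; case: asboolP; rewrite ?lexx ?ler01. Qed.

Lemma Ymean_bounds N n : 0 <= Ymean R b N.+1 n <= 1.
Proof.
have HE := expectation_expect N; rewrite /Ymean.
rewrite -{1}(expect_cst HE 0) -(expect_cst HE 1).
by apply/andP; split; apply: (expect_le HE) => x; have /andP[] := Y_bounds n x.
Qed.

Lemma Y_dev_le1 N n x : `|Y R b n x - Ymean R b N.+1 n| <= 1.
Proof.
have /andP[? ?] := Y_bounds n x; have /andP[? ?] := Ymean_bounds N n.
by rewrite ler_norml; apply/andP; split; lra.
Qed.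

Lemma Yvar_ge0 N n : 0 <= Yvar R b N.+1 n.
Proof.
have HE := expectation_expect N; rewrite -(expect_cst HE 0).
by apply: (expect_le HE) => x; exact: sqr_ge0.
Qed.

Lemma YvarE N n : Yvar R b N.+1 n = Ymean R b N.+1 n * (1 - Ymean R b N.+1 n).
Proof.
have HE := expectation_expect N; rewrite /Yvar; set m := Ymean _ _ _ _.
(* As [Y] takes only the values 0 and 1, its squared deviation is an affine function of [Y]. *)
transitivity (expect b N.+1 (fun x => (1 - 2 * m) * Y R b n x + m ^+ 2)).
  congr expect; apply/funext => x.
  by rewrite /Y; case: asboolP => _; ring.
rewrite (expectD HE) (expectZ HE) (expect_cst HE) -/(Ymean R b N.+1 n) -/m.
by ring.
Qed.

(** With [c] the size of the bin, the variance is [c / (c + 1) ^+ 2], and [c + 1 <= 2 * c] because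
    [1 <= c]. *)
Lemma Yvar_ge N n : (n < N)%N -> 4^-1 * (b n.+1)%:R^-1 <= Yvar R b N.+1 n.+1.
Proof.
move=> nN; rewrite YvarE YmeanE// -[(b n.+1).+1%:R]natr1; set c := (b n.+1)%:R.
have c1 : 1 <= c by rewrite ler1n; exact: b_gt0.
have -> : c / (c + 1) * (1 - c / (c + 1)) = c / (c + 1) ^+ 2 by field; lra.
rewrite -invfM ler_pdivlMr; last by rewrite exprn_gt0; lra.
rewrite mulrC ler_pdivrMr; last by lra.
by nra.
Qed.

End digit_independence.

(** * Stein's equation *)

Section gauss_mean.
Context {R : realType}.
Implicit Types h f g : R -> R.
Notation mu := (@lebesgue_measure R).
Notation phi := (@normal_pdf R 0 1).

Definition bounded_measurable h : Prop :=
  measurable_fun setT h /\ exists M, forall x, `|h x| <= M.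

Definition gauss_mean h : R := \int[mu]_x (h x * phi x).

Lemma bounded_measurableD h1 h2 : bounded_measurable h1 ->
  bounded_measurable h2 -> bounded_measurable (fun x => h1 x + h2 x).
Proof.
move=> [m1 [M1 h1M]] [m2 [M2 h2M]]; split; first exact: measurable_funD.
by exists (M1 + M2) => x; rewrite (le_trans (ler_normD _ _)) ?lerD.
Qed.

Lemma bounded_measurableZ a h :
  bounded_measurable h -> bounded_measurable (fun x => a * h x).
Proof.
move=> [mh [M hM]]; split; first exact: measurable_funM.
by exists (`|a| * M) => x; rewrite normrM ler_wpM2l.
Qed.

Lemma gauss_integrable h : bounded_measurable h ->
  mu.-integrable setT (EFin \o (fun x => h x * phi x)).
Proof.
move=> [mh [M hM]].
apply: (@le_integrable _ _ _ mu setT measurableT _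
  (fun x => (M * phi x)%:E)) => //.
- apply/measurable_EFinP; apply: measurable_funM => //.
  exact: measurable_normal_pdf.
- move=> x _ /=; rewrite lee_fin !normrM ler_wpM2r//.
  exact: le_trans (hM x) (ler_norm _).
- under eq_fun do rewrite EFinM.
  by apply: integrableZl => //; exact: integrable_normal_pdf.
Qed.

Lemma gauss_mean_le h1 h2 : bounded_measurable h1 -> bounded_measurable h2 ->
  (forall x, h1 x <= h2 x) -> gauss_mean h1 <= gauss_mean h2.
Proof.
move=> bh1 bh2 h12; apply: le_Rintegral => //; try exact: gauss_integrable.
by move=> x _; rewrite ler_wpM2r ?normal_pdf_ge0.
Qed.

Lemma gauss_meanD h1 h2 : bounded_measurable h1 -> bounded_measurable h2 ->
  gauss_mean (fun x => h1 x + h2 x) = gauss_mean h1 + gauss_mean h2.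
Proof.
move=> bh1 bh2; rewrite -RintegralD//; try exact: gauss_integrable.
by apply: eq_Rintegral => x _; rewrite mulrDl.
Qed.

Lemma gauss_meanZ a h : bounded_measurable h ->
  gauss_mean (fun x => a * h x) = a * gauss_mean h.
Proof.
move=> bh; rewrite -RintegralZl//; last exact: gauss_integrable.
by apply: eq_Rintegral => x _; rewrite mulrA.
Qed.

Lemma gauss_mean_indic (A : set R) : measurable A ->
  (gauss_mean \1_A)%:E = normal_prob 0 1 A.
Proof.
move=> mA; have fin : normal_prob (0 : R) 1 A \is a fin_num.
  exact: fin_num_measure.
rewrite -(fineK fin) /normal_prob; congr EFin.
rewrite -/(Rintegral mu A phi) Rintegral_mkcond.
apply: eq_Rintegral => x _; rewrite patchE indicE.
by case: ifP => xA; rewrite ?mul1r ?mul0r.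
Qed.

Lemma bounded_measurable_indic (A : set R) : measurable A ->
  bounded_measurable \1_A.
Proof.
move=> mA; split; first exact: measurable_indic.
exists 1 => x; rewrite indicE.
by case: (x \in A); rewrite ?normr1 ?normr0 ?ler01.
Qed.

Lemma gauss_mean_cst a : gauss_mean (fun=> a) = a.
Proof.
have b1 : bounded_measurable (fun=> 1).
  by split => //; exists 1 => x; rewrite normr1.
have := gauss_meanZ a b1; rewrite mulr1 => ->.
rewrite -[RHS]mulr1; congr (_ * _).
apply: EFin_inj; have := @gauss_mean_indic setT measurableT.
rewrite /normal_prob integral_normal_pdf => <-; congr (gauss_mean _)%:E.
by apply/funext => x; rewrite indicT.
Qed.

Lemma normal_pdf1E (x : R) : phi x = normal_peak 1 * expR (- (x ^+ 2 / 2)).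
Proof.
rewrite normal_pdfE ?oner_neq0// /normal_fun subr0 expr1n.
by rewrite mulNr.
Qed.

(* [F / phi] solves Stein's equation [f' - x f = h] when [F] is the primitive of
   [h * phi] vanishing at [-oo]; as [h] has compact support and Gaussian mean
   zero, it also vanishes outside the support of [h]. *)
Definition gauss_primitive h (x : R) : R :=
  \int[mu]_(t in `]-oo, x]) (h t * phi t).

Lemma is_derive_gauss_primitive h (x : R) : bounded_measurable h ->
  continuous h -> is_derive x 1 (gauss_primitive h) (h x * phi x).
Proof.
(* The fundamental theorem is applied at a point interior to a half-line; [x + 1] is an arbitrary
   endpoint beyond [x]. *)
move=> bh ch; have xx1 : x < x + 1 by rewrite ltrDl.
have := @continuous_FTC1 R (fun t => h t * phi t) -oo%O x (x + 1) xx1.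
case.
- by apply: integrableS (gauss_integrable bh).
- by rewrite ltNyr.
- apply: cvgM; first exact: ch.
  by apply: continuous_normal_pdf; rewrite oner_neq0.
by move=> dF; rewrite derive1E => F'; exact: DeriveDef dF F'.
Qed.

(** To the left of the support the integrand is zero; to the right the integral is already the full
    Gaussian mean, which is zero. *)
Lemma gauss_primitive_out h (A x : R) :
  (forall t, A <= `|t| -> h t = 0) -> 0 < A ->
  gauss_mean h = 0 -> A <= `|x| -> gauss_primitive h x = 0.
Proof.
move=> hA A0 h0 Ax; rewrite /gauss_primitive Rintegral_mkcond.
have [x0|x0] := leP 0 x.
  rewrite ger0_norm// in Ax; rewrite -[RHS]h0; apply: eq_Rintegral => t _.
  rewrite patchE; case: ifPn => //; rewrite notin_setE/= in_itv/= => /negP.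
  by rewrite -ltNge => xt; rewrite hA ?mul0r// ger0_norm; lra.
rewrite ltr0_norm// in Ax; transitivity (Rintegral mu setT (cst 0)).
  apply: eq_Rintegral => t _; rewrite patchE; case: ifPn => //.
  rewrite inE/= in_itv/= => tx.
  by rewrite hA ?mul0r// ltr0_norm; lra.
by rewrite Rintegral_cst// mul0r.
Qed.

Lemma is_derive_continuous f g : (forall x : R, is_derive x 1 f (g x)) ->
  continuous f.
Proof.
move=> fg x; apply: differentiable_continuous; apply/derivable1_diffP.
by have [] := fg x.
Qed.

(** The mean value theorem for increments of either sign. The location of [y] serves to turn a
    Lipschitz bound on [g] into a second-order Taylor bound on [f]. *)
Lemma MVT_increment f g (x u : R) : (forall y : R, is_derive y 1 f (g y)) ->
  exists2 y, `|y - x| <= `|u| & f (x + u) - f x = u * g y.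
Proof.
move=> fg; have fc := is_derive_continuous fg.
have [u0|u0] := leP 0 u.
- have xu : x <= x + u by rewrite lerDl.
  have [y yxu yE] := MVT_segment xu (fun y _ => fg y) (continuous_subspaceT fc).
  exists y; last by rewrite yE mulrC; congr (_ * _); lra.
  by move: yxu; rewrite in_itv/= => /andP[? ?]; rewrite !ger0_norm; lra.
- have xu : x + u <= x by lra.
  have [y yxu yE] := MVT_segment xu (fun y _ => fg y) (continuous_subspaceT fc).
  exists y; last by rewrite -opprB yE; ring.
  move: yxu; rewrite in_itv/= => /andP[? ?].
  by rewrite (ltr0_norm u0) ler0_norm; lra.
Qed.

Definition lipschitz_with (L : R) h := forall x y, `|h x - h y| <= L * `|x - y|.

Lemma lipschitz_with_continuous L h : lipschitz_with L h -> continuous h.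
Proof.
move=> hL x; apply/cvgrPdist_le => e e0; near=> y.
apply: le_trans (hL _ _) _; have L1 : 0 < `|L| + 1 by rewrite ltr_wpDl.
have : `|x - y| <= e / (`|L| + 1).
  near: y; apply: (@cvgr_dist_le _ _ _ _ (nbhs_filter x)); first exact: cvg_id.
  exact: divr_gt0.
rewrite ler_pdivlMr// => xy; apply: le_trans xy; rewrite mulrC ler_wpM2l//.
by have := ler_norm L; lra.
Unshelve. all: by end_near. Qed.

(** The solution is [F / phi], with derivative [g x = h x + x * f x]. As [h] is only Lipschitz, [g]
    need not be differentiable; but [x * f x] is, and its derivative is continuous with compact
    support, hence bounded by some [M]. So [g] is Lipschitz with constant [L + M], and the Taylor
    bound on [f] follows by the mean value theorem. *)
Lemma stein_solution h (A L : R) : lipschitz_with L h ->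
  0 < A -> (forall x, A <= `|x| -> h x = 0) -> gauss_mean h = 0 ->
  exists f g K, [/\ forall x u, `|f (x + u) - f x - u * g x| <= K * u ^+ 2,
    lipschitz_with K g & forall x, g x - x * f x = h x].
Proof.
move=> hL A0 hA h0; have hc := lipschitz_with_continuous hL.
have L0 : 0 <= L.
  have := hL 1 0; rewrite subr0 normr1 mulr1; exact: le_trans.
have bh : bounded_measurable h.
  split; first exact: continuous_measurable_fun.
  (* Inside the support, [h x] is compared with [h A = 0], at distance at most [2 * A]. *)
  exists (L * (2 * A)) => x; have [xA|/hA->] := ltP `|x| A; last first.
    by rewrite normr0; nra.
  have hAA : h A = 0 by rewrite hA// ler_norm.
  have := hL x A; rewrite hAA subr0 => /le_trans; apply.
  move: xA; rewrite ltr_norml => /andP[? ?]; rewrite ler_wpM2l// ler0_norm; lra.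
pose F := gauss_primitive h.
(* [w] is the reciprocal of the Gaussian density, and satisfies [w' = x w]. *)
pose w (x : R) : R := (normal_peak 1)^-1 * expR (2^-1 * x ^+ 2).
pose f x := F x * w x.
pose g x := h x + x * f x.
have wphi x : w x * phi x = 1.
  have p0 : normal_peak (1 : R) != 0.
    by rewrite gt_eqF// normal_peak_gt0// oner_neq0.
  rewrite normal_pdf1E /w mulrACA mulVf// mul1r mulrC [_ / 2]mulrC.
  by rewrite expRN mulVf// gt_eqF// expR_gt0.
have dw (x : R) : is_derive x 1 w (x * w x).
  have d1 : is_derive x 1 (fun y : R => 2^-1 * y ^+ 2) x.
    have := is_deriveM (is_derive_cst (2^-1 : R) x 1)
      (is_deriveX 2 (is_derive_id x 1)).
    move=> /is_derive_eq; apply; rewrite !scaler0 addr0 /cst /= expr1.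
    by rewrite /GRing.scale/= mulr1; field.
  have d2 := is_derive1_comp (is_derive_expR _) d1.
  have := is_deriveM (is_derive_cst ((normal_peak 1)^-1 : R) x 1) d2.
  move=> /is_derive_eq; apply; rewrite !scaler0 addr0 /cst /= /w.
  by rewrite /GRing.scale/=; ring.
have df (x : R) : is_derive x 1 f (g x).
  have dF := is_derive_gauss_primitive x bh hc.
  have := is_deriveM dF (dw x); move=> /is_derive_eq; apply.
  rewrite /GRing.scale/= -/F.
  transitivity (h x * (w x * phi x) + x * (F x * w x)); first by ring.
  by rewrite wphi mulr1.
have fA x : A <= `|x| -> f x = 0.
  by move=> Ax; rewrite /f /F (gauss_primitive_out hA)// mul0r.
pose q x := x * f x; pose q' x := f x + x * g x.
have dq (x : R) : is_derive x 1 q (q' x).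
  have := is_deriveM (is_derive_id x 1) (df x); move=> /is_derive_eq; apply.
  by rewrite /GRing.scale/= mulr1 addrC.
have fc := is_derive_continuous df.
have qc : continuous q'.
  move=> x; apply: cvgD; first exact: fc.
  apply: cvgM; first exact: cvg_id.
  apply: cvgD; first exact: hc.
  by apply: cvgM; [exact: cvg_id|exact: fc].
have [M qM] : exists M, forall x, `|q' x| <= M.
  have AA : - A <= A by lra.
  have [|c _ cM] := @EVT_max _ (fun x => `|q' x|) _ _ AA.
    apply: continuous_subspaceT => x; apply: cvg_norm; exact: qc.
  exists `|q' c| => x; have [xA|Ax] := leP `|x| A.
    by apply: cM; rewrite in_itv/=; move: xA; rewrite ler_norml.
  by rewrite /q' /g (fA _ (ltW Ax)) (hA _ (ltW Ax)) !(mulr0, addr0) normr0.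
have gL : lipschitz_with (L + M) g.
  move=> x y; have -> : g x - g y = (h x - h y) + (q x - q y).
    by rewrite /g /q; lra.
  apply: le_trans (ler_normD _ _) _; rewrite mulrDl lerD//.
  have [z _] := MVT_increment y (x - y) dq; rewrite [y + _]addrC subrK => ->.
  by rewrite normrM mulrC ler_wpM2r.
exists f, g, (L + M); split => // [x u|x]; last by rewrite /g; lra.
have [z zu ->] := MVT_increment x u df.
rewrite -mulrBr normrM -real_normK ?num_real// expr2 mulrCA ler_wpM2l//.
apply: le_trans (gL _ _) _; rewrite ler_wpM2l//.
by have := qM 0; have := normr_ge0 (q' 0); lra.
Qed.

End gauss_mean.

(** * Convergence of the distribution functions *)

Section trapezoid.
Context {R : realType}.
Variables a b e : R.
Hypothesis e0 : 0 < e.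

(** The formula is also meaningful for [b < a]: the bounds, the support and the Lipschitz constant
    persist, so that [- K] and [t] can later be used as endpoints without comparing them. *)
Definition trapezoid (x : R) : R :=
  Num.max 0 (Num.min 1 (Num.min ((x - a) / e + 1) ((b - x) / e + 1))).

Lemma trapezoid_ge0 x : 0 <= trapezoid x.
Proof. by rewrite /trapezoid le_max lexx. Qed.

Lemma trapezoid_le1 x : trapezoid x <= 1.
Proof. by rewrite /trapezoid ge_max ler01 ge_min lexx. Qed.

Lemma trapezoid_in x : a <= x <= b -> trapezoid x = 1.
Proof.
move=> /andP[ax xb].
have ? : 0 <= (x - a) / e by apply: divr_ge0; [lra|exact: ltW].
have ? : 0 <= (b - x) / e by apply: divr_ge0; [lra|exact: ltW].
have -> : trapezoid x = Num.max 0 1.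
  congr Num.max; apply/min_idPl; rewrite le_min; apply/andP; split; lra.
exact/max_idPr/ler01.
Qed.

Lemma trapezoid_out x : (x <= a - e) || (b + e <= x) -> trapezoid x = 0.
Proof.
move=> /orP xab; apply/max_idPl; rewrite !ge_min.
case: xab => ?; apply/orP; right; apply/orP; [left|right].
- have : (x - a) / e <= -1 by rewrite ler_pdivrMr//; lra.
  lra.
- have : (b - x) / e <= -1 by rewrite ler_pdivrMr//; lra.
  lra.
Qed.

Lemma lipschitz_with_min L (f g : R -> R) : lipschitz_with L f ->
  lipschitz_with L g -> lipschitz_with L (fun x => Num.min (f x) (g x)).
Proof.
move=> fL gL x y; have := fL x y; have := gL x y; rewrite !ler_norml.
by move=> /andP[? ?] /andP[? ?]; apply/andP; split;
  case: (leP (f x) (g x)) => ?; case: (leP (f y) (g y)) => ?; lra.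
Qed.

Lemma lipschitz_with_max L (f g : R -> R) : lipschitz_with L f ->
  lipschitz_with L g -> lipschitz_with L (fun x => Num.max (f x) (g x)).
Proof.
move=> fL gL x y; have := fL x y; have := gL x y; rewrite !ler_norml.
by move=> /andP[? ?] /andP[? ?]; apply/andP; split;
  case: (leP (f x) (g x)) => ?; case: (leP (f y) (g y)) => ?; lra.
Qed.

Lemma lipschitz_with_trapezoid : lipschitz_with e^-1 trapezoid.
Proof.
have e1 : 0 <= e^-1 by rewrite invr_ge0 ltW.
have cL (c : R) : lipschitz_with e^-1 (fun=> c).
  by move=> x y; rewrite subrr normr0 mulr_ge0.
apply: lipschitz_with_max => //; apply: lipschitz_with_min => //.
apply: lipschitz_with_min => x y.
- have -> : (x - a) / e + 1 - ((y - a) / e + 1) = e^-1 * (x - y) by ring.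
  by rewrite normrM ger0_norm.
- have -> : (b - x) / e + 1 - ((b - y) / e + 1) = e^-1 * (y - x) by ring.
  by rewrite normrM ger0_norm// (distrC x).
Qed.

Lemma bounded_measurable_trapezoid : bounded_measurable trapezoid.
Proof.
split.
  apply: continuous_measurable_fun.
  exact: lipschitz_with_continuous lipschitz_with_trapezoid.
by exists 1 => x; rewrite ger0_norm ?trapezoid_ge0 ?trapezoid_le1.
Qed.

End trapezoid.

(** * From Stein's equation to the distribution functions *)

Section stein_clt.
Context {R : realType}.
Notation gauss_cdf := (fun t : R => gauss_mean \1_`]-oo, t]%classic).

Lemma gauss_cdf_continuous : continuous gauss_cdf.
Proof.
have b1 : bounded_measurable (fun=> 1 : R).
  by split => //; exists 1 => x; rewrite normr1.
have -> : gauss_cdf = gauss_primitive (fun=> 1).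
  apply/funext => t; rewrite /gauss_mean /gauss_primitive [RHS]Rintegral_mkcond.
  apply: eq_Rintegral => x _; rewrite patchE indicE.
  by case: ifP => xA; rewrite ?mul1r ?mul0r.
apply: is_derive_continuous => x; apply: is_derive_gauss_primitive => //.
by move=> y; exact: cvg_cst.
Qed.

(** Continuity from below of the normal law along the intervals [J n], which exhaust the line. *)
Lemma gauss_tight (eta : R) : 0 < eta ->
  \forall n \near \oo, 1 - eta <= gauss_mean \1_`[- n%:R, n%:R]%classic.
Proof.
move=> eta0.
pose J n : set R := `[- n%:R, n%:R]%classic.
have JT : \bigcup_n J n = setT.
  apply/seteqP; split => // x _; exists (Num.trunc `|x|).+1 => //.
  rewrite /J/= in_itv/= -ler_norml; apply: ltW; exact: truncnS_gt.
have Jmono : {homo J : m n / (m <= n)%N >-> (m <= n)%O}.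
  move=> m n mn; apply/subsetPset => x; rewrite /J/= !in_itv/= => /andP[? ?].
  have : m%:R <= n%:R :> R by rewrite ler_nat.
  by move=> ?; apply/andP; split; lra.
have mJ n : measurable (J n) by exact: measurable_itv.
have mJT : measurable (\bigcup_n J n) by rewrite JT; exact: measurableT.
have := @nondecreasing_cvg_mu _ _ R (normal_prob 0 1) J mJ mJT Jmono.
have PT : normal_prob (0 : R) 1 (\bigcup_n J n) = 1%:E.
  by rewrite JT; exact: integral_normal_pdf.
rewrite [X in _ --> X]PT.
have -> : normal_prob (0 : R) 1 \o J = EFin \o (fun n => gauss_mean \1_(J n)).
  by apply/funext => n /=; rewrite gauss_mean_indic.
move=> /fine_cvgP[_ /cvgrPdist_le/(_ _ eta0)].
apply: filterS => n /=; rewrite ler_norml => /andP[_]; lra.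
Qed.

(** [E N h] stands for the mean of [h] at the [N]-th standardized sum. The hypotheses hold only
    eventually because the first level is empty and the first standard deviations may vanish. *)
Variable E : nat -> (R -> R) -> R.
Hypothesis HE : \forall N \near \oo, expectation (E N).
Hypothesis E_sqr : \forall N \near \oo, E N (fun x => x ^+ 2) <= 1.
Hypothesis E_stein : forall (f g : R -> R) K,
  (forall x u, `|f (x + u) - f x - u * g x| <= K * u ^+ 2) ->
  lipschitz_with K g ->
  E N (fun x => g x - x * f x) @[N --> \oo] --> 0.

(** Here [h2] plays the role of the constant 1, which lacks compact support: when both of its means
    are close to 1, the two means of [h1] are close to each other. *)
Lemma compare_gauss_means (h1 h2 : R -> R) (A L1 L2 : R) :
  lipschitz_with L1 h1 -> lipschitz_with L2 h2 ->
  bounded_measurable h1 -> bounded_measurable h2 -> 0 < A ->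
  (forall x, A <= `|x| -> h1 x = 0) -> (forall x, A <= `|x| -> h2 x = 0) ->
  E N h1 * gauss_mean h2 - E N h2 * gauss_mean h1 @[N --> \oo] --> 0.
Proof.
move=> h1L h2L bh1 bh2 A0 h1A h2A.
set I1 := gauss_mean h1; set I2 := gauss_mean h2.
pose h x := I2 * h1 x + (- I1) * h2 x.
have hL : lipschitz_with (`|I2| * L1 + `|I1| * L2) h.
  move=> x y; have -> : h x - h y = I2 * (h1 x - h1 y) + (- I1) * (h2 x - h2 y).
    by rewrite /h; ring.
  apply: le_trans (ler_normD _ _) _; rewrite !normrM normrN mulrDl -!mulrA.
  by rewrite lerD// ler_wpM2l.
have h0 : gauss_mean h = 0.
  rewrite gauss_meanD ?gauss_meanZ//; try exact: bounded_measurableZ.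
  by rewrite -/I1 -/I2; ring.
have hA x : A <= `|x| -> h x = 0.
  by move=> Ax; rewrite /h h1A// h2A// !mulr0 addr0.
have [f [g [K [fK gK fg]]]] := stein_solution hL A0 hA h0.
apply: cvg_trans (E_stein fK gK); apply: near_eq_cvg; near=> N.
have HN : expectation (E N) by near: N.
have -> : (fun x => g x - x * f x) = h by apply/funext.
by rewrite (expectD HN) !(expectZ HN); ring.
Unshelve. all: by end_near. Qed.

Lemma stein_cdf_cvg (t : R) :
  E N \1_`]-oo, t]%classic @[N --> \oo] --> gauss_cdf t.
Proof.
apply/cvgrPdist_le => eps eps0.
(* Both the upper and the lower estimate lose [4 * eta] in all; an eighth of [eps] leaves a
   margin. *)
pose eta := eps / 8; have eta0 : 0 < eta by rewrite divr_gt0.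
have [e e0 [up lo]] : exists2 e, 0 < e &
    gauss_cdf (t + e) <= gauss_cdf t + eta /\
    gauss_cdf t - eta <= gauss_cdf (t - e).
  have /cvgrPdist_le/(_ _ eta0) := @gauss_cdf_continuous t.
  rewrite -nbhs_nearE => /nbhs_ballP[d d0 dP].
  have d2 : 0 < d / 2 by rewrite divr_gt0.
  exists (d / 2) => //; split.
    have /= := dP (t + d / 2); rewrite /ball/= opprD addNKr normrN gtr0_norm//.
    rewrite ltr_pdivrMr// ltr_pMr// ltr1n ler_norml.
    by move=> /(_ isT)/andP[? _]; lra.
  have /= := dP (t - d / 2); rewrite /ball/= subKr gtr0_norm//.
  by rewrite ltr_pdivrMr// ltr_pMr// ltr1n ler_norml => /(_ isT)/andP[_ ?]; lra.
(* One [K] controls two tails: [K ^- 2] bounds that of the sums by Chebyshev's inequality, and the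
   last condition bounds the Gaussian one. *)
have [K [K0 Keta Ktail]] : exists K : R, [/\ 0 < K, K ^- 2 <= eta &
    1 - eta <= gauss_mean \1_`[- K, K]%classic].
  near \oo => n; have nK : 1 + eta^-1 <= n%:R :> R.
    by near: n; exact: nbhs_infty_ger.
  have ie0 : 0 < eta^-1 by rewrite invr_gt0.
  have n0 : 0 < n%:R :> R by lra.
  exists n%:R; split => //; last by near: n; exact: gauss_tight.
  rewrite -[eta]invrK lef_pV2 ?posrE ?exprn_gt0//; nra.
(* On [[- K, K]], [hu] dominates the indicator of []-oo, t]]; [hl] vanishes beyond [t], so it lies
   below that indicator everywhere. *)
pose hu := trapezoid (- K) t e; pose hl := trapezoid (- K) (t - e) e.
pose h := trapezoid (- K) K 1.
have bhu : bounded_measurable hu := bounded_measurable_trapezoid _ _ e0.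
have bhl : bounded_measurable hl := bounded_measurable_trapezoid _ _ e0.
have bh : bounded_measurable h := bounded_measurable_trapezoid _ _ ltr01.
have bI (i : interval R) : bounded_measurable \1_[set` i].
  by apply: bounded_measurable_indic; exact: measurable_itv.
have b1 (c : R) : bounded_measurable (fun=> c) by split => //; exists `|c|.
have Ih1 : gauss_mean h <= 1.
  rewrite -(gauss_mean_cst 1); apply: gauss_mean_le => // x.
  exact: trapezoid_le1.
have Ihl1 : gauss_mean hl <= 1.
  rewrite -(gauss_mean_cst 1); apply: gauss_mean_le => // x.
  exact: trapezoid_le1.
have Ihu0 : 0 <= gauss_mean hu.
  rewrite -(gauss_mean_cst 0); apply: gauss_mean_le => // x.
  exact: trapezoid_ge0.
have Ih : 1 - eta <= gauss_mean h.
  apply: le_trans Ktail _; apply: gauss_mean_le => // x.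
  rewrite indicE; case: (boolP (x \in _)) => [|_]; last exact: trapezoid_ge0.
  by rewrite inE/= in_itv/= => xK; rewrite /h trapezoid_in.
have Ihu : gauss_mean hu <= gauss_cdf t + eta.
  apply: le_trans up; apply: gauss_mean_le => // x.
  rewrite indicE; case: (boolP (x \in _)) => [_|]; first exact: trapezoid_le1.
  rewrite notin_setE/= in_itv/= => /negP; rewrite -ltNge => /ltW xt.
  by rewrite /hu trapezoid_out// xt orbT.
have Ihl : gauss_cdf t - 2 * eta <= gauss_mean hl.
  (* If [x] lies both in []-oo, t - e]] and in [[- K, K]], then [hl x] is 1; hence the sum of the
     two indicators is at most [hl x + 1]. *)
  have : gauss_cdf (t - e) + gauss_mean \1_`[- K, K]%classic <=
      gauss_mean hl + 1.
    rewrite -(gauss_mean_cst 1) -!gauss_meanD//.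
    apply: gauss_mean_le => [||x]; try exact: bounded_measurableD.
    rewrite !indicE.
    case: (boolP (x \in `]-oo, _]%classic)) => [xt|_]; last first.
      rewrite add0r; apply: ler_wpDl; first exact: trapezoid_ge0.
      by case: (_ \in _).
    case: (boolP (x \in _)) => [xK|_]; last first.
      by rewrite addr0 lerDr trapezoid_ge0.
    move: xt xK; rewrite !inE/= !in_itv/= => xt /andP[xK _].
    by rewrite /hl trapezoid_in// xK.
  lra.
(* Large enough for [[- A, A]] to contain the supports of the three trapezoids, whose slopes have
   widths [e] and 1. *)
pose A := K + `|t| + e + 1.
have A0 : 0 < A by rewrite /A; have := normr_ge0 t; lra.
have tA : - `|t| <= t <= `|t| by rewrite -ler_norml.
have outA a x : a <= `|t| -> A <= `|x| -> (x <= - K - e) || (a + e <= x).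
  move: tA => /andP[? ?] ?.
  by rewrite /A ler_normr => /orP[?|?]; apply/orP; [right|left]; lra.
have huA x : A <= `|x| -> hu x = 0.
  by move=> /outA xA; apply: trapezoid_out => //; apply: xA; lra.
have hlA x : A <= `|x| -> hl x = 0.
  by move=> /outA xA; apply: trapezoid_out => //; apply: xA; lra.
have hA x : A <= `|x| -> h x = 0.
  move=> xA; apply: trapezoid_out => //; have t0 := normr_ge0 t; move: xA.
  by rewrite /A ler_normr => /orP[?|?]; apply/orP; [right|left]; lra.
have eL := @lipschitz_with_trapezoid R.
have /cvgrPdist_le/(_ _ eta0) cu :=
  compare_gauss_means (eL _ _ _ e0) (eL _ _ _ ltr01) bhu bh A0 huA hA.
have /cvgrPdist_le/(_ _ eta0) cl :=
  compare_gauss_means (eL _ _ _ e0) (eL _ _ _ ltr01) bhl bh A0 hlA hA.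
near=> N.
have HN : expectation (E N) by near: N.
have E2 : E N (fun x => K ^- 2 * x ^+ 2) <= eta.
  rewrite (expectZ HN); apply: le_trans Keta; rewrite ler_piMr//.
    by rewrite invr_ge0 sqr_ge0.
  by near: N.
have EN01 a c d : 0 <= E N (trapezoid a c d) <= 1.
  rewrite -{1}(expect_cst HN 0) -(expect_cst HN 1).
  by apply/andP; split; apply: (expect_le HN) => x;
    [exact: trapezoid_ge0|exact: trapezoid_le1].
(* Chebyshev's inequality in pointwise form: [K ^- 2 * x ^+ 2] dominates the indicator of the region
   beyond [K]. *)
have K2 x : K < `|x| -> 1 <= K ^- 2 * x ^+ 2.
  move=> Kx; rewrite mulrC ler_pdivlMr ?exprn_gt0// mul1r.
  rewrite -(real_normK (num_real x)).
  by nra.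
have K20 x : 0 <= K ^- 2 * x ^+ 2 by rewrite mulr_ge0// ?invr_ge0 sqr_ge0.
have Eh : 1 - eta <= E N h.
  rewrite lerBlDr -[leLHS](expect_cst HN); apply: le_trans (lerD (lexx _) E2).
  rewrite -(expectD HN); apply: (expect_le HN) => x.
  have [xK|/K2 xK] := leP `|x| K; last by rewrite ler_wpDl// trapezoid_ge0.
  by rewrite /h trapezoid_in ?lerDl// -ler_norml.
have Eu : E N \1_`]-oo, t]%classic <= E N hu + eta.
  apply: le_trans (lerD (lexx _) E2).
  rewrite -(expectD HN); apply: (expect_le HN) => x.
  rewrite indicE; case: (boolP (x \in _)) => [|_]; last first.
    by rewrite addr_ge0// trapezoid_ge0.
  rewrite inE/= in_itv/= => xt.
  have [xK|/K2 xK] := leP `|x| K; last by rewrite ler_wpDl// trapezoid_ge0.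
  rewrite /hu trapezoid_in ?lerDl// xt andbT.
  by move: xK; rewrite ler_norml => /andP[].
have El : E N hl <= E N \1_`]-oo, t]%classic.
  apply: (expect_le HN) => x.
  rewrite indicE; case: (boolP (x \in _)) => [_|]; first exact: trapezoid_le1.
  rewrite notin_setE/= in_itv/= => /negP; rewrite -ltNge => /ltW xt.
  by rewrite /hl trapezoid_out// subrK xt orbT.
have : `|0 - (E N hu * gauss_mean h - E N h * gauss_mean hu)| <= eta by near: N.
have : `|0 - (E N hl * gauss_mean h - E N h * gauss_mean hl)| <= eta by near: N.
have /andP[? ?] := EN01 (- K) t e; have /andP[? ?] := EN01 (- K) (t - e) e.
have /andP[? ?] := EN01 (- K) K 1.
rewrite -/hu -/hl -/h !sub0r !normrN !ler_norml => /andP[? ?] /andP[? ?].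
have epsE : eps = 8 * eta by rewrite /eta; field.
(* In the two comparisons, the means of [h] lie between [1 - eta] and 1, so replacing each by 1
   costs at most [eta]. *)
rewrite epsE; apply/andP; split; nra.
Unshelve. all: by end_near. Qed.

End stein_clt.

(** * The number of summands *)

Section number_of_summands.
Variables (R : realType) (b : nat -> nat).
Hypothesis b_gt0 : forall n, (1 <= n)%N -> (0 < b n)%N.

Definition standardized N x : R :=
  (stddev R b N)^-1 * \sum_(1 <= n < N.+1) (Y R b n x - Ymean R b N n).

Lemma prob_expect N (A : set R) :
  prob R b N.+1 [set x | A (standardized N.+1 x)] =
  expect b N.+1 (fun x => \1_A (standardized N.+1 x)).
Proof.
rewrite /expect /prob; congr (_ / _).
have fin := finite_level b_gt0 N.
set s := fset_set (level b N.+1); set P := fun x => standardized N.+1 x \in A.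
have /perm_size -> : perm_eq
    (fset_set (level b N.+1 `&` [set x | A (standardized N.+1 x)]))
    [seq x <- s | P x].
  apply: uniq_perm; [exact: fset_uniq|exact/filter_uniq/fset_uniq|move=> x].
  rewrite mem_filter in_fset_set; last exact: finite_setIl.
  rewrite /s in_fset_set// in_setI andbC; congr (_ && _).
rewrite size_filter -sum1_count natr_sum big_mkcond/=.
by apply: eq_bigr => x _; rewrite indicE /P; case: ifP.
Qed.

Section fixed_level.
Variable N : nat.
Let s := stddev R b N.+1.
Hypothesis s0 : 0 < s.
Let xi n x : R := s^-1 * (Y R b n.+1 x - Ymean R b N.+1 n.+1).
Let HE := expectation_expect R b_gt0 N.

Let standardizedE x : standardized N.+1 x = \sum_(n < N.+1) xi n x.
Proof. by rewrite /standardized mulr_sumr big_add1 big_mkord. Qed.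

Let xi_le n x : `|xi n x| <= s^-1.
Proof.
rewrite normrM gtr0_norm ?invr_gt0// ler_piMr//.
  by rewrite invr_ge0 ltW.
exact: Y_dev_le1.
Qed.

Let rest_invariant n (v : R -> R) : (n < N.+1)%N ->
  digit_invariant b N.+1 n
    (fun x => v (\sum_(m < N.+1) xi m x - xi n x)).
Proof.
move=> nN x y _ _ xy; congr v.
have restE z : \sum_(m < N.+1) xi m z - xi n z =
    \sum_(m < N.+1 | m != Ordinal nN) xi m z.
  by rewrite (bigD1 (Ordinal nN))//= addrAC subrr add0r.
by rewrite !restE; apply: eq_bigr => m mn; rewrite /xi !YE// xy.
Qed.

Let xi_centered n (v : R -> R) : (n < N.+1)%N ->
  expect b N.+1 (fun x => xi n x * v (\sum_(m < N.+1) xi m x - xi n x)) = 0.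
Proof.
move=> nN.
rewrite (expect_Y_indep (N := N) (n := n) b_gt0
  (fun y => s^-1 * (y - Ymean R b N.+1 n.+1)) nN (rest_invariant v nN)).
by rewrite (expectZ HE) (expectB HE) (expect_cst HE) subrr mulr0 mul0r.
Qed.

Let xi_var n (v : R -> R) : (n < N.+1)%N ->
  expect b N.+1 (fun x => xi n x ^+ 2 * v (\sum_(m < N.+1) xi m x - xi n x)) =
  expect b N.+1 (fun x => xi n x ^+ 2) *
  expect b N.+1 (fun x => v (\sum_(m < N.+1) xi m x - xi n x)).
Proof.
move=> nN.
exact: (expect_Y_indep (N := N) (n := n) b_gt0
  (fun y => (s^-1 * (y - Ymean R b N.+1 n.+1)) ^+ 2) nN (rest_invariant v nN)).
Qed.

Lemma sum_Yvar : \sum_(1 <= n < N.+2) Yvar R b N.+1 n = s ^+ 2.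
Proof. by rewrite sqr_sqrtr// sumr_ge0// => n _; exact: Yvar_ge0. Qed.

Let var_sum : \sum_(n < N.+1) expect b N.+1 (fun x => xi n x ^+ 2) = 1.
Proof.
transitivity (s ^- 2 * \sum_(1 <= n < N.+2) Yvar R b N.+1 n).
  rewrite big_add1 big_mkord mulr_sumr; apply: eq_bigr => n _.
  rewrite -(expectZ HE); congr expect; apply/funext => x.
  by rewrite /xi exprMn exprVn.
by rewrite sum_Yvar mulVf// expf_neq0// gt_eqF.
Qed.

Lemma expect_standardized_sqr :
  expect b N.+1 (fun x => standardized N.+1 x ^+ 2) = 1.
Proof.
rewrite -[RHS](expect_sum_sqr HE xi_centered var_sum).
by congr expect; apply/funext => x; rewrite standardizedE.
Qed.

Lemma standardized_stein_bound (f g : R -> R) (K : R) :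
  (forall x u, `|f (x + u) - f x - u * g x| <= K * u ^+ 2) ->
  lipschitz_with K g ->
  `|expect b N.+1 (fun x => g (standardized N.+1 x)
      - standardized N.+1 x * f (standardized N.+1 x))| <= 2 * K * s^-1.
Proof.
move=> fK gK; have := stein_bound HE xi_centered xi_var xi_le var_sum fK gK.
apply: le_trans; rewrite le_eqVlt; apply/orP; left; apply/eqP; congr (`|_|).
by congr expect; apply/funext => x; rewrite standardizedE.
Qed.

Lemma lyapunov_ratio_le :
  0 <= (s `^ (2 + 1))^-1 * \sum_(1 <= n < N.+2)
     expect b N.+1 (fun x => `|Y R b n x - Ymean R b N.+1 n| `^ (2 + 1)) <=
  s^-1.
Proof.
have p3 (x : R) : 0 <= x -> x `^ (2 + 1) = x ^+ 3.
  by move=> x0; rewrite -powR_mulrn//; congr powR; lra.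
rewrite p3; last exact: ltW.
(* The bound is rewritten as a sum of variances, to be compared termwise with the third absolute
   moments. *)
have -> : s^-1 = s ^- 3 * \sum_(1 <= n < N.+2) Yvar R b N.+1 n.
  by rewrite sum_Yvar; field; rewrite gt_eqF.
have s3 : 0 <= s ^- 3 by rewrite invr_ge0 exprn_ge0 ?ltW.
apply/andP; split.
  rewrite mulr_ge0// sumr_ge0// => n _; rewrite -(expect_cst HE 0).
  by apply: (expect_le HE) => x; exact: powR_ge0.
rewrite ler_wpM2l// ler_sum// => n _; apply: (expect_le HE) => x.
rewrite p3// exprSr real_normK ?num_real// ler_piMr ?sqr_ge0//.
exact: Y_dev_le1.
Qed.

End fixed_level.

(** Bin 0 does not exist and its level is empty, so the estimates are proved at [N.+1] and carried
    over to limits in [N] by this shift. *)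
Lemma near_infty_S (P : nat -> Prop) : (\forall N \near \oo, P N.+1) ->
  \forall N \near \oo, P N.
Proof.
move=> [m _ mP]; exists m.+1 => // -[//|N] /= mN; exact: mP.
Qed.

(** * Divergence of the standard deviation and the two limits *)

Hypothesis b_div : ~ cvgn (fun N : nat => \sum_(1 <= n < N.+1) (b n)%:R^-1 : R).

Lemma stddev_unbounded (A : R) : \forall N \near \oo, A <= stddev R b N.+1.
Proof.
pose u N : R := \sum_(1 <= n < N.+1) (b n)%:R^-1.
have ndu : nondecreasing_seq u.
  apply/nondecreasing_seqP => n.
  by rewrite /u [leRHS]big_nat_recr//= lerDl invr_ge0 ler0n.
(* A nondecreasing sequence of partial sums that stayed below [4 * A ^+ 2] would converge; the 4
   compensates the constant in [Yvar_ge]. *)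
have [m mA] : exists m, 4 * A ^+ 2 <= u m.
  apply: contrapT => h; apply: b_div; apply: nondecreasing_is_cvgn => //.
  exists (4 * A ^+ 2) => _ [m _ <-]; rewrite leNgt; apply/negP => /ltW mA.
  by apply: h; exists m.
exists m => // N /= mN.
apply: le_trans (ler_norm A) _; rewrite -sqrtr_sqr; apply: ler_wsqrtr.
have uN : 4 * A ^+ 2 <= u N by apply: le_trans mA (ndu _ _ mN).
have uV : 4^-1 * u N <= \sum_(1 <= n < N.+1) Yvar R b N.+1 n.
  rewrite mulr_sumr !big_add1/= ler_sum_nat// => n /andP[_ nN].
  exact: Yvar_ge.
(* The top bin, outside the range of [Yvar_ge], contributes a nonnegative variance. *)
rewrite [leRHS]big_nat_recr//=; have := Yvar_ge0 R b_gt0 N N.+1; lra.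
Qed.

Lemma stddev_inv_cvg0 : (stddev R b N)^-1 @[N --> \oo] --> 0.
Proof.
apply/cvgrPdist_le => e e0; apply: near_infty_S; near=> N.
have ie0 : 0 < e^-1 by rewrite invr_gt0.
have sN : e^-1 <= stddev R b N.+1 by near: N; exact: stddev_unbounded.
rewrite sub0r normrN ger0_norm; last by rewrite invr_ge0; lra.
by rewrite -[e]invrK lef_pV2 ?posrE//; lra.
Unshelve. all: by end_near. Qed.

Lemma lyapunov : lyapunov_condition R b.
Proof.
exists 1 => //; apply: (squeeze_cvgr _ (cvg_cst 0) stddev_inv_cvg0).
apply: near_infty_S; near=> N; apply: lyapunov_ratio_le.
apply: lt_le_trans ltr01 _; near: N; exact: stddev_unbounded.
Unshelve. all: by end_near. Qed.

Lemma standardized_sum_cvg : standardized_sum_cvg_normal R b.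
Proof.
move=> t.
pose E N (h : R -> R) : R := expect b N (fun x => h (standardized N x)).
have spos : \forall N \near \oo, 0 < stddev R b N.+1.
  near=> N; apply: lt_le_trans ltr01 _; near: N; exact: stddev_unbounded.
have HE N : expectation (E N.+1).
  have HN := expectation_expect R b_gt0 N.
  split => [f g|a f|f g fg|]; rewrite /E.
  - exact: (expectD HN).
  - exact: (expectZ HN).
  - by apply: (expect_le HN) => x.
  - exact: (expect_cst HN).
have E2 : \forall N \near \oo, E N (fun x => x ^+ 2) <= 1.
  apply: near_infty_S; apply: filterS spos => N s0.
  by rewrite /E expect_standardized_sqr.
have ES (f g : R -> R) K :
    (forall x u, `|f (x + u) - f x - u * g x| <= K * u ^+ 2) ->
    lipschitz_with K g ->
    E N (fun x => g x - x * f x) @[N --> \oo] --> 0.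
  move=> fK gK; apply/norm_cvg0P.
  (* For a fixed test pair the constant [K] does not depend on [N], so the Stein bound tends to 0
     with the inverse of the standard deviation. *)
  have c0 : 2 * K * (stddev R b N)^-1 @[N --> \oo] --> 0.
    by rewrite -(mulr0 (2 * K)); apply: cvgM stddev_inv_cvg0; exact: cvg_cst.
  apply: (squeeze_cvgr _ (cvg_cst 0) c0); apply: near_infty_S.
  apply: filterS spos => N s0; rewrite normr_ge0/=.
  exact: standardized_stein_bound.
have HE' : \forall N \near \oo, expectation (E N).
  by apply: near_infty_S; near=> N.
have := stein_cdf_cvg HE' E2 ES (t := t); rewrite -gauss_mean_indic//.
move=> cE; apply: cvg_EFin; first by near=> N.
apply: cvg_trans cE; apply: near_eq_cvg; apply: near_infty_S; near=> N.
rewrite /= /E -prob_expect; congr (prob R b _ _); apply/seteqP; split => x /=;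
by rewrite in_itv.
Unshelve. all: by end_near. Qed.

End number_of_summands.

Theorem theorem1p2 (R : realType) (b : nat -> nat)
    (b_gt0 : forall n, (1 <= n)%N -> (0 < b n)%N)
    (b_div : ~ cvgn (fun N : nat => \sum_(1 <= n < N.+1) (b n)%:R^-1 : R)) :
  lyapunov_condition R b /\ standardized_sum_cvg_normal R b.
Proof. by split; [exact: lyapunov|exact: standardized_sum_cvg]. Qed.
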